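(* Let $\boldsymbol{u}\in\mathbb{R}^d$, $\boldsymbol{a}\in(0,\infty)^d$, $\boldsymbol{\sigma}\in(0,\infty)^d$, $\boldsymbol{\gamma}\in\mathbb{R}^d$, and let $F_{\text{bulk}}$ be a distribution function on $\mathbb{R}^d$ with density $f_{\text{bulk}}$. Let $F$ be the distribution on $\mathbb{R}^d$ with density $$f(\boldsymbol{x})=\begin{cases} f_{\text{bulk}}(\boldsymbol{x}), & \text{if } \boldsymbol{x}\le \boldsymbol{u}\ (\text{i.e. } x_j\le u_j \text{ for all } j),\\ [1-F_{\text{bulk}}(\boldsymbol{u})]\,h_{\boldsymbol{U}}(\boldsymbol{x}-\boldsymbol{u}\mid\boldsymbol{a},\boldsymbol{\sigma},\boldsymbol{\gamma}), & \text{otherwise,}\end{cases}$$ where $h_{\boldsymbol{U}}(\cdot\mid\boldsymbol{a},\boldsymbol{\sigma},\boldsymbol{\gamma})$ is the multivariate generalised Pareto density with independent reverse exponential generator. Then $F$ lies in the max-domain of attraction of a multivariate generalised extreme value distribution, regardless of the choice of the bulk distribution $F_{\text{bulk}}$.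
   Context: Operations and inequalities on vectors are componentwise. Multivariate generalised Pareto density with independent reverse exponential generator. For $\boldsymbol{a},\boldsymbol{\sigma}\in(0,\infty)^d$ and $\boldsymbol{\gamma}\in\mathbb{R}^d$, the standardised density is, for $\boldsymbol{z}\in\mathbb{R}^d$, $$h_{\boldsymbol{U}}(\boldsymbol{z})=\mathbb{1}\{\max(\boldsymbol{z})>0\}\,\frac{\exp[-\max(\boldsymbol{z})(1+\sum_{j=1}^d a_j^{-1})]}{c(\boldsymbol a)}\cdot\frac{\prod_{j=1}^d a_j^{-1}\exp(a_j^{-1}z_j)}{1+\sum_{j=1}^d a_j^{-1}},\qquad c(\boldsymbol a)=\frac{\sum_{j=1}^d a_j^{-1}}{1+\sum_{j=1}^d a_j^{-1}}.$$ On the observation scale, for $\boldsymbol{x}$ with $\gamma_jx_j+\sigma_j>0$ for all $j$, $$h_{\boldsymbol{U}}(\boldsymbol{x}\mid\boldsymbol{a},\boldsymbol{\sigma},\boldsymbol{\gamma})=h_{\boldsymbol{U}}(\boldsymbol{z})\prod_{j=1}^d(\gamma_jx_j+\sigma_j)^{-1},\qquad z_j=\frac{1}{\gamma_j}\log\left(\frac{\gamma_j}{\sigma_j}x_j+1\right),$$ where $z_j$ is read as $x_j/\sigma_j$ when $\gamma_j=0$; the density is $0$ at all other $\boldsymbol{x}$. Max-domain of attraction. A distribution function $F$ of a $d$-dimensional random vector $\boldsymbol{Y}$ is in the max-domain of attraction of a distribution function $G$ with non-degenerate margins if there exist sequences $\boldsymbol{\alpha}_n\in(0,\infty)^d$ and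 $\boldsymbol{\beta}_n\in\mathbb{R}^d$ with $\mathbb{P}(\boldsymbol{\alpha}_n\boldsymbol{Y}+\boldsymbol{\beta}_n\le\boldsymbol{y})^n\to G(\boldsymbol{y})$ as $n\to\infty$. The distributions $G$ with non-degenerate margins arising as such limits are the multivariate generalised extreme value distributions; their margins are univariate generalised extreme value distributions.
   Formalization: The formal statement additionally assumes F_bulk(u) < 1; if F_bulk(u) = 1 the tail has no weight, F equals F_bulk, and the claim fails (e.g. d = 1 with 1 − F_bulk(u − s) = −1/log s for small s > 0). *)

(* Defs.v *)
From HB Require Import structures.
From mathcomp Require Import all_boot all_order all_algebra.
From mathcomp Require Import all_classical all_reals all_analysis.

Set Implicit Arguments.
Unset Strict Implicit.
Unset Printing Implicit Defensive.

Import Order.TTheory GRing.Theory Num.Theory numFieldNormedType.Exports.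

Local Open Scope classical_set_scope.
Local Open Scope ring_scope.

(* Vectors of R^n are tuples [n.-tuple R], whose library sigma-algebra is the
   one generated by the coordinates, i.e. the Borel sigma-algebra of R^n.  The
   library has Lebesgue measure on R and binary products only, so Lebesgue
   measure on R^n is built as an iterated product; [lebesgue_tuple_box] below
   checks its value on boxes. *)
Section lebesgue_tuple.
Context {R : realType}.

Definition cons_pair n (p : measurableTypeR R * n.-tuple R) : n.+1.-tuple R :=
  [tuple of (p.1 : R) :: p.2].

Lemma measurable_cons_pair n : measurable_fun [set: _] (@cons_pair n).
Proof.
apply: (@measurable_cons _ _ _ R
  (fun p : measurableTypeR R * n.-tuple R => p.1 : R) n snd).
  exact: measurable_fst.
exact: measurable_snd.
Qed.

Section step.
Variables (n : nat) (mu : {sigma_finite_measure set (n.-tuple R) -> \bar R}).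

Definition lebesgue_cons : set (n.+1.-tuple R) -> \bar R :=
  pushforward (lebesgue_measure \x mu)%E (@cons_pair n).

Let lebesgue_cons0 : lebesgue_cons set0 = 0%E.
Proof. by rewrite /lebesgue_cons /pushforward preimage_set0 measure0. Qed.

Let lebesgue_cons_ge0 A : (0 <= lebesgue_cons A)%E.
Proof. by rewrite /lebesgue_cons /pushforward; exact: measure_ge0. Qed.

Let lebesgue_cons_sigma_additive : semi_sigma_additive lebesgue_cons.
Proof.
move=> F mF tF mUF; rewrite /lebesgue_cons /pushforward preimage_bigcup.
have mc A : measurable A -> measurable (@cons_pair n @^-1` A).
  by move=> mA; rewrite -[X in measurable X]setTI; exact: measurable_cons_pair.
apply: measure_semi_sigma_additive.
- by move=> k; exact: mc.
- apply/trivIsetP => /= i j _ _ ij; rewrite -preimage_setI.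
  by move/trivIsetP : tF => /(_ _ _ _ _ ij) ->//; rewrite preimage_set0.
- by rewrite -preimage_bigcup; exact: mc.
Qed.

HB.instance Definition _ := isMeasure.Build _ _ _ lebesgue_cons
  lebesgue_cons0 lebesgue_cons_ge0 lebesgue_cons_sigma_additive.

Let lebesgue_cons_sigma_finite : sigma_finite setT lebesgue_cons.
Proof.
have /sigma_finiteP[F [FT ndF Foo]] := sigma_finiteT (@lebesgue_measure R).
have /sigma_finiteP[G [GT ndG Goo]] := sigma_finiteT mu.
exists (fun k => [set t | F k (thead t) /\ G k [tuple of behead t]]).
  apply/esym/seteqP; split => // t _.
  have [i _ Fi] : (\bigcup_i F i) (thead t) by rewrite -FT.
  have [j _ Gj] : (\bigcup_i G i) [tuple of behead t] by rewrite -GT.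
  exists (maxn i j) => //; split.
  - by move: Fi; exact/subsetPset/ndF/leq_maxl.
  - by move: Gj; exact/subsetPset/ndG/leq_maxr.
move=> k; have [mF Fk] := Foo k; have [mG Gk] := Goo k; split.
  apply: measurableI.
  - rewrite -[X in measurable X]setTI.
    exact: (@measurable_tnth _ R n.+1 ord0).
  - by rewrite -[X in measurable X]setTI; exact: measurable_behead.
rewrite /lebesgue_cons /pushforward.
rewrite (_ : _ @^-1` _ = F k `*` G k); last first.
  have E (x : R) (t : n.-tuple R) : [tuple of behead [tuple of x :: t]] = t.
    exact: val_inj.
  by apply/seteqP; split => -[x t] /=; rewrite /cons_pair/= theadE E.
by rewrite product_measure1E// lte_mul_pinfty// ge0_fin_numE.
Qed.

HB.instance Definition _ := @Measure_isSigmaFinite.Build _ _ _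
  lebesgue_cons lebesgue_cons_sigma_finite.

End step.

Fixpoint lebesgue_tuple n : {sigma_finite_measure set (n.-tuple R) -> \bar R} :=
  match n with
  | 0 => \d_([tuple] : 0.-tuple R)
  | m.+1 => lebesgue_cons (lebesgue_tuple m)
  end.

Lemma lebesgue_tuple_box n (A : 'I_n -> set R) :
  (forall i, measurable (A i)) ->
  lebesgue_tuple n [set x | forall i, A i (tnth x i)] =
  (\prod_(i < n) lebesgue_measure (A i : set (measurableTypeR R)))%E.
Proof.
elim: n A => [A _|n IH A mA].
  rewrite big_ord0 /= diracE mem_set//= => -[]//.
rewrite big_ord_recl -IH; last by move=> i; exact: mA.
rewrite /= /lebesgue_cons /pushforward -product_measure1E; last 2 first.
- exact: mA.
- rewrite (_ : [set _ | _] =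
    \bigcap_(i in [set: 'I_n]) ((@tnth _ R ^~ i) @^-1` (A (lift ord0 i)))).
    apply: fin_bigcap_measurable => // i _; rewrite -[X in measurable X]setTI.
    exact: measurable_tnth.
  by apply/seteqP; split => x /= h i; [move=> _|]; exact: h.
congr (product_measure1 _ _ _); apply/seteqP; split => -[x t] /=.
- move=> h; split; first exact: (h ord0).
  by move=> i; have := h (lift ord0 i); rewrite tnthS.
- move=> [h0 h] i; case: (unliftP ord0 i) => [j ->|->]; last exact: h0.
  by rewrite tnthS; exact: h.
Qed.

End lebesgue_tuple.

Section densities_and_distribution_functions.
Context {R : realType} {d : nat}.
Implicit Types (P : probability (d.-tuple R) R) (x y : d.-tuple R).

Definition has_density P (f : d.-tuple R -> R) : Prop :=
  [/\ measurable_fun [set: d.-tuple R] f,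
      (forall x, 0 <= f x) &
      forall A, measurable A ->
        P A = (\int[lebesgue_tuple d]_(x in A) (f x)%:E)%E].

Definition distribution_function P y : R :=
  fine (P [set x | forall j, tnth x j <= tnth y j]).

(* No one-dimensional margin is a point mass. *)
Definition nondegenerate_margins P : Prop :=
  forall j c, (P [set x | tnth x j = c] < 1)%E.

(* A distribution is represented by its law: [P] is the law of the vector Y,
   so the inner set is the event alpha_n Y + beta_n <= y.  Convergence is
   required at every y. *)
Definition max_domain_of_attraction P (G : probability (d.-tuple R) R) : Prop :=
  nondegenerate_margins G /\
  exists alpha beta : nat -> d.-tuple R,
    (forall n j, 0 < tnth (alpha n) j) /\
    forall y,
      (fun n : nat => fine (P [set x | forall j,
         tnth (alpha n) j * tnth x j + tnth (beta n) j <= tnth y j]) ^+ n)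
        @ \oo --> distribution_function G y.

Definition multivariate_gev (G : probability (d.-tuple R) R) : Prop :=
  exists P, max_domain_of_attraction P G.

End densities_and_distribution_functions.

(* The dimension is written d.+1 so that the maximum of the coordinates is over
   a nonempty index set. *)
Section generalised_pareto.
Context {R : realType} {d : nat}.
Implicit Types (a sigma gamma x z u : d.+1.-tuple R).

Definition vmax z : R := \big[Num.max/tnth z ord0]_(j < d.+1) tnth z j.

Definition sum_inv a : R := \sum_(j < d.+1) (tnth a j)^-1.

Definition mgp_const a : R := sum_inv a / (1 + sum_inv a).

Definition mgp_std_density a z : R :=
  if 0 < vmax z then
    expR (- vmax z * (1 + sum_inv a)) / mgp_const a *
    ((\prod_(j < d.+1) ((tnth a j)^-1 * expR ((tnth a j)^-1 * tnth z j))) /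
     (1 + sum_inv a))
  else 0.

Definition mgp_standardise sigma gamma x : d.+1.-tuple R :=
  [tuple if tnth gamma j == 0 then tnth x j / tnth sigma j
         else (tnth gamma j)^-1 *
              ln (tnth gamma j / tnth sigma j * tnth x j + 1) | j < d.+1].

Definition mgp_density a sigma gamma x : R :=
  if [forall j, 0 < tnth gamma j * tnth x j + tnth sigma j] then
    mgp_std_density a (mgp_standardise sigma gamma x) *
    \prod_(j < d.+1) (tnth gamma j * tnth x j + tnth sigma j)^-1
  else 0.

Definition bulk_tail_density (Fbulk : probability (d.+1.-tuple R) R)
    (fbulk : d.+1.-tuple R -> R) u a sigma gamma x : R :=
  if [forall j, tnth x j <= tnth u j] then fbulk x
  else (1 - distribution_function Fbulk u) *
       mgp_density a sigma gamma [tuple tnth x j - tnth u j | j < d.+1].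

End generalised_pareto.

(* Main.v *)
(* Adding [t] to every coordinate of the standardised tail vector is, on the
   observation scale, a diagonal affine flow [S_t], and the density makes [F]
   threshold stable along it: F (S_t A) = exp (-t) F A for t >= 0 and A disjoint
   from {x <= u}.  So n F {x | not x <= S_(ln n) y} is eventually a constant
   V(y), and F {x <= S_(ln n) y}^n -> exp (- V(y)).

   It remains to realise exp (-V) as a distribution function.  Let [G_k] be the
   law of S_(-k) M, where M is the maximum of [u] and of a Poisson number, of
   mean e^k, of independent draws from [F].  Its distribution function is
   exp (-V) above b_k := S_(-k) u and 0 elsewhere; hence the G_k are projective
   for the maps x |-> max (b_k, x), and since G_k {x > b_k} -> 1 they glue to a
   probability with distribution function exp (-V). *)

Require Import Defs.
From HB Require Import structures.
From mathcomp Require Import all_boot all_order all_algebra.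
From mathcomp Require Import all_classical all_reals all_analysis.
From mathcomp Require Import measurable_realfun ring lra.
Set Implicit Arguments.
Unset Strict Implicit.
Unset Printing Implicit Defensive.
Import Order.TTheory GRing.Theory Num.Theory numFieldNormedType.Exports.
Local Open Scope classical_set_scope.
Local Open Scope ring_scope.

(** * Lower orthants as a generating pi-system, and componentwise maxima *)

Section orthants.
Context {R : realType} {n : nat}.
Local Notation T := (n.-tuple R).
Implicit Types (x y u : T) (A : set T).

Definition lower_orthant y : set (n.-tuple R) :=
  [set x | forall j, tnth x j <= tnth y j].

Lemma measurable_le_tnth j (c : R) :
  measurable [set x : n.-tuple R | tnth x j <= c].
Proof.
rewrite (_ : [set _ | _] = (@tnth n R ^~ j) @^-1` `]-oo, c]%classic).
  by rewrite -[X in measurable X]setTI; exact: measurable_tnth.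
by apply/seteqP; split => x /=; rewrite in_itv.
Qed.

Lemma measurable_lower_orthant y : measurable (lower_orthant y).
Proof.
rewrite (_ : lower_orthant y =
    \bigcap_(i in [set: 'I_n]) [set x : n.-tuple R | tnth x i <= tnth y i]).
  by apply: fin_bigcap_measurable => // i _; exact: measurable_le_tnth.
by apply/seteqP; split => x /= h i; [move=> _|]; exact: h.
Qed.

(** A half-space bounding one coordinate is the union over k of the lower orthants whose other
    bounds are all k, and such half-spaces generate the coordinate preimages. *)
Lemma sigma_algebra_lower_orthant :
  @measurable _ (n.-tuple R) = <<s range lower_orthant >>.
Proof.
apply/seteqP; split; last first.
  apply: smallest_sub; first exact: sigma_algebra_measurable.
  by move=> _ [y _ <-]; exact: measurable_lower_orthant.
suff coord (i : 'I_n) (B : set R) : measurable B ->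
    <<s range lower_orthant >> ((@tnth n R ^~ i) @^-1` B).
  apply: smallest_sub; first exact: smallest_sigma_algebra.
  move=> A; rewrite -bigcup_seq => -[i _] [B mB <-]; rewrite setTI.
  exact: coord.
pose f : g_sigma_algebraType (range lower_orthant) -> R := @tnth n R ^~ i.
move=> mB; rewrite -[X in <<s _ >> X]setTI.
suff : measurable_fun setT f by move=> /(_ measurableT B mB).
apply: (measurability (@RGenOInfty.G R)); first exact: RGenOInfty.measurableE.
move=> _ [_ [c ->] <-]; rewrite setTI.
pose U := \bigcup_k lower_orthant [tuple if j == i then c else k%:R | j < n].
suff E : U = ~` (f @^-1` `]c, +oo[%classic).
  rewrite -[_ @^-1` _]setCK -E; apply: measurableC.
  apply: bigcup_measurable => k _; apply: sub_sigma_algebra.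
  by exists [tuple if j == i then c else k%:R | j < n].
apply/seteqP; split => x /=.
  move=> [k _ /(_ i)]; rewrite /= tnth_mktuple eqxx in_itv/= andbT => h.
  by apply/negP; rewrite -leNgt.
rewrite in_itv/= andbT => /negP; rewrite -leNgt => xic.
pose M := \sum_(j < n) `|tnth x j|.
exists (Num.truncn M).+1 => // j; rewrite tnth_mktuple.
case: ifPn => [/eqP->//|_].
rewrite (le_trans (ler_norm _))// (@le_trans _ _ M)//.
  by rewrite /M (bigD1 j)//= lerDl sumr_ge0.
by apply/ltW; exact: truncnS_gt.
Qed.

(** Lower orthants are stable under intersection, through componentwise minima, and those with all
    bounds k exhaust the space, so uniqueness on a pi-system applies. *)
Lemma probability_lower_orthant_unique (P Q : probability (n.-tuple R) R) :
  (forall y, P (lower_orthant y) = Q (lower_orthant y)) ->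
  forall A, measurable A -> P A = Q A.
Proof.
move=> PQ A mA.
apply: (measure_unique (range lower_orthant)
  (fun k => lower_orthant [tuple k%:R | j < n])) => //.
- exact: sigma_algebra_lower_orthant.
- move=> _ _ [x _ <-] [y _ <-].
  exists [tuple Num.min (tnth x j) (tnth y j) | j < n] => //.
  apply/seteqP; split => z /=.
    by move=> h; split => j; have := h j; rewrite tnth_mktuple le_min => /andP[].
  by move=> [hx hy] j; rewrite tnth_mktuple le_min hx hy.
- apply/seteqP; split => // x _.
  pose M := \sum_(j < n) `|tnth x j|.
  exists (Num.truncn M).+1 => // j; rewrite tnth_mktuple.
  rewrite (le_trans (ler_norm _))// (@le_trans _ _ M)//.
    by rewrite /M (bigD1 j)//= lerDl sumr_ge0.
  by apply/ltW; exact: truncnS_gt.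
- by move=> _ [y _ <-]; exact: PQ.
- move=> k; rewrite (le_lt_trans (probability_le1 _ _)) ?ltey//.
  exact: measurable_lower_orthant.
Qed.

Definition tmax x y : n.-tuple R :=
  [tuple Num.max (tnth x j) (tnth y j) | j < n].

Definition tmax_pair (p : T * T) : T := tmax p.1 p.2.

Lemma measurable_tmax_pair : measurable_fun [set: T * T] tmax_pair.
Proof.
apply/measurable_fun_tnthP => i /=.
rewrite (_ : _ \o _ = (fun p : n.-tuple R * n.-tuple R => tnth p.1 i) \max
                      (fun p => tnth p.2 i)); last first.
  by apply/funext => p /=; rewrite tnth_mktuple.
apply: measurable_maxr.
- exact: (measurableT_comp (measurable_tnth i) measurable_fst).
- exact: (measurableT_comp (measurable_tnth i) measurable_snd).
Qed.

HB.instance Definition _ :=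
  isMeasurableFun.Build _ _ _ _ tmax_pair measurable_tmax_pair.

Lemma lower_orthant_tmax y x x' : lower_orthant y (tmax x x') <->
  lower_orthant y x /\ lower_orthant y x'.
Proof.
split=> [h|[h h'] j]; last by rewrite tnth_mktuple ge_max h h'.
by split=> j; have := h j; rewrite tnth_mktuple ge_max => /andP[].
Qed.

End orthants.

(** * Maxima of a Poisson number of independent vectors *)

Section max_poisson.
Context {R : realType} {n : nat}.
Local Notation T := (n.-tuple R).
Implicit Types (P Q : probability T R) (u : T) (A : set T).

(** Isolates the sets for which the probability of containing a maximum of independent vectors is a
    product. *)
Definition max_closed A := forall x y, A (tmax x y) <-> A x /\ A y.

Definition max_convolution P Q : probability T R :=
  distribution (P \x Q)%E tmax_pair.

Fixpoint max_power P u k : probability T R :=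
  if k is k'.+1 then max_convolution (max_power P u k') P else \d_u.

Lemma max_powerE P u k A : measurable A -> max_closed A ->
  max_power P u k A = (\1_A u * fine (P A) ^+ k)%:E.
Proof.
move=> mA cA; elim: k => [|k IH]; first by rewrite /= diracE expr0 mulr1.
rewrite /= /max_convolution/= /distribution /pushforward.
rewrite (_ : _ @^-1` _ = A `*` A); last first.
  by apply/seteqP; split => -[x y] /= /cA.
rewrite product_measure1E// [X in (X * _)%E]IH exprSr mulrA [in RHS]EFinM fineK//.
exact: fin_num_measure.
Qed.

(** The powers of c merge with those of lambda into the exponential series of lambda c. *)
Lemma poisson_generating_function (lambda c : R) : 0 < lambda -> 0 <= c ->
  (\sum_(0 <= k <oo) (poisson_pmf lambda k * c ^+ k)%:E =
   (expR (- lambda * (1 - c)))%:E)%E.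
Proof.
move=> l0 c0.
under eq_eseriesr.
  move=> k _; rewrite /poisson_pmf l0 mulrAC mulrC (mulrAC (lambda ^+ k)).
  rewrite -exprMn EFinM; over.
rewrite nneseriesZl/=; last first.
  by move=> k _; rewrite lee_fin divr_ge0// exprn_ge0// mulr_ge0// ltW.
rewrite mulrBr mulr1 mulNr opprK expRD EFinM; congr *%E.
rewrite expRE -EFin_lim; last first.
  rewrite /pseries/=; under eq_fun do rewrite mulrC.
  exact: is_cvg_series_exp_coeff.
apply/congr_lim/funext => k/=; rewrite /pseries/= /series/= -sumEFin//.
by under eq_bigr do rewrite mulrC.
Qed.

(* The law of the maximum of [u] and of N independent copies of [P], where N is
   Poisson with mean [expR t]. *)
Definition max_poisson P u (t : R) : set T -> \bar R :=
  mseries (fun k =>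
    mscale (NngNum (poisson_pmf_ge0 (expR t) k)) (max_power P u k)) 0.

Section max_poisson_probability.
Variables (P : probability T R) (u : T) (t : R).

HB.instance Definition _ := Measure.on (max_poisson P u t).

(** Summing over the number of draws gives the Poisson generating function at P A; the floor [u]
    contributes the indicator. *)
Lemma max_poissonE A : measurable A -> max_closed A ->
  max_poisson P u t A = (\1_A u * expR (- expR t * fine (P (~` A))))%:E.
Proof.
move=> mA cA; rewrite /max_poisson /mseries.
transitivity (\sum_(0 <= k <oo)
    ((\1_A u)%:E * (poisson_pmf (expR t) k * fine (P A) ^+ k)%:E))%E.
  apply: eq_eseriesr => k _; rewrite [LHS]/= /mscale [X in (_ * X)%E]max_powerE//.
  rewrite -!EFinM.
  by rewrite mulrCA.
rewrite nneseriesZl//=; last first.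
  by move=> k _; rewrite lee_fin mulr_ge0 ?poisson_pmf_ge0// exprn_ge0// fine_ge0.
rewrite poisson_generating_function ?expR_gt0 ?fine_ge0//.
by rewrite probability_setC// fineB// ?fin_num_measure.
Qed.

Let max_poisson_setT : max_poisson P u t setT = 1%E.
Proof.
by rewrite max_poissonE// indicT setCT measure0 /= mulr0 expR0 mulr1.
Qed.

HB.instance Definition _ :=
  Measure_isProbability.Build _ _ R (max_poisson P u t) max_poisson_setT.

End max_poisson_probability.
End max_poisson.

(** * Gluing laws that are consistent under truncation from below *)

Section projective_limit.
Context {R : realType} {n : nat}.
Local Notation T := (n.-tuple R).
Variables (G : nat -> probability T R) (b : nat -> T).
Hypothesis b_ni : forall k j, tnth (b k.+1) j <= tnth (b k) j.
Hypothesis G_proj : forall k A, measurable A ->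
  G k.+1 (tmax (b k) @^-1` A) = G k A.

Definition upper_orthant (y : T) : set T :=
  [set x | forall j, tnth y j < tnth x j].

Lemma upper_orthantE y : upper_orthant y =
  \bigcap_(j in [set: 'I_n]) ~` [set x : T | tnth x j <= tnth y j].
Proof.
apply/seteqP; split => x /= h j; first by move=> _; apply/negP; rewrite -ltNge.
by have /negP := h j I; rewrite -ltNge.
Qed.

Lemma measurable_upper_orthant y : measurable (upper_orthant y).
Proof.
rewrite upper_orthantE; apply: fin_bigcap_measurable => // j _.
by apply: measurableC; exact: measurable_le_tnth.
Qed.

Let O k := upper_orthant (b k).

Hypothesis G_O : (fun k => G k (~` O k)) @ \oo --> 0%E.

Let mO k : measurable (O k). Proof. exact: measurable_upper_orthant. Qed.

Let O_nd : nondecreasing_seq O.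
Proof.
apply/nondecreasing_seqP => k; apply/subsetPset => x Ox j.
exact: le_lt_trans (b_ni k j) (Ox j).
Qed.

(** Truncation at [b i] is the identity on [O i], and the sets [O i] grow, so each projectivity step
    from k on preserves the mass of A. *)
Let G_stable k i A : measurable A -> A `<=` O k -> (k <= i)%N -> G i A = G k A.
Proof.
move=> mA AO ki; rewrite -(subnK ki); elim: (i - k)%N => [//|l <-].
rewrite addSn -[RHS](G_proj (l + k) mA); congr (G _ _).
have AOl : A `<=` O (l + k)%N.
  by apply: (subset_trans AO); apply/subsetPset/O_nd; exact: leq_addl.
have tmaxE x : O (l + k)%N x -> tmax (b (l + k)) x = x.
  move=> Ox; apply: eq_from_tnth => j; rewrite tnth_mktuple.
  by apply/max_idPr/ltW.
apply/seteqP; split => x /= Ax; first by rewrite tmaxE//; exact: AOl.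
(* A maximum strictly above [b (l + k)] is attained by x, so x was not truncated. *)
rewrite -(tmaxE x)// => j; have := AOl _ Ax j.
by rewrite tnth_mktuple lt_max ltxx.
Qed.

Local Notation D := (seqDU O).

Let mD k : measurable (D k).
Proof. by apply: measurableD => //; exact: bigsetU_measurable. Qed.

Let DO k : D k `<=` O k. Proof. by move=> x []. Qed.

(* All the laws [G i] with [k <= i] agree on subsets of [O k], so the pieces
   [G k] restricted to [D k] are consistent. *)
Definition projective_limit : set T -> \bar R :=
  mseries (fun k => mrestr (G k) (mD k)) 0.

HB.instance Definition _ := Measure.on projective_limit.

Let projective_limitE k A : measurable A ->
  projective_limit (A `&` O k) = G k (A `&` O k).
Proof.
move=> mA; have mAO : measurable (A `&` O k) by exact: measurableI.
have AODO i : A `&` O k `&` D i `<=` O i by move=> x [_ /DO].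
transitivity (\sum_(0 <= i <oo) G k (A `&` O k `&` D i))%E.
  apply: eq_eseriesr => i _; rewrite /= /mrestr.
  have mAOD : measurable (A `&` O k `&` D i) by exact: measurableI.
  (* For i <= k the laws [G k] and [G i] agree inside [O i]; for i > k the piece [D i] avoids
     [O k]. *)
  have [ki|ik] := leqP i k; first by rewrite (G_stable mAOD _ ki).
  rewrite (_ : _ `&` D i = set0) ?measure0//; apply/seteqP; split => // x.
  move=> [[_ Okx] [_]]; apply.
  by rewrite -bigcup_mkord; exists k.
rewrite -measure_semi_bigcup//.
- congr (G k _); rewrite -setI_bigcupr -seqDU_bigcup_eq.
  by rewrite setIidl// => x [_ Ox]; exists k.
- by move=> i; apply: measurableI.
- by apply/trivIset_setIl; exact: trivIset_seqDU.
- by apply: bigcupT_measurable => i; exact: measurableI.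
Qed.

Let cvg_G_O A : measurable A ->
  (fun k => G k (A `&` O k)) @ \oo --> projective_limit A.
Proof.
move=> mA.
(* Every piece [D i] lies in the union of the [O k], so intersecting with it loses no mass. *)
have -> : projective_limit A = projective_limit (\bigcup_k (A `&` O k)).
  apply: eq_eseriesr => i _; rewrite /= /mrestr -setI_bigcupr; congr (G i _).
  rewrite -setIA; congr (_ `&` _); apply/esym/setIidr => x /DO Ox.
  by exists i.
rewrite (_ : (fun k => _) = projective_limit \o (fun k => A `&` O k)).
  apply: nondecreasing_cvg_mu.
  - by move=> k; exact: measurableI.
  - by apply: bigcupT_measurable => k; exact: measurableI.
  - move=> k l kl; apply/subsetPset; apply: setIS.
    exact/subsetPset/O_nd.
by apply/funext => k /=; rewrite projective_limitE.
Qed.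

(** [G_O] discards the part off [O k], and the rest converges by continuity from below. On the whole
    space this gives total mass one. *)
Let cvg_projective_limit A : measurable A ->
  (fun k => G k A) @ \oo --> projective_limit A.
Proof.
move=> mA.
rewrite (_ : (fun k => G k A) =
    (fun k => G k (A `&` O k) + G k (A `&` ~` O k))%E); last first.
  by apply/funext => k; rewrite -setDE addeC -measureDI.
have G0 : (fun k => G k (A `&` ~` O k)) @ \oo --> 0%E.
  apply: (@squeeze_cvge _ _ _ _ (cst 0%E) _ (fun k => G k (~` O k))).
  - apply: nearW => k; rewrite measure_ge0/=.
    by apply: le_measure; rewrite ?inE//;
      [apply: measurableI => //|]; exact: measurableC.
  - exact: cvg_cst.
  - exact: G_O.
rewrite -[X in _ --> X]adde0; apply: cvgeD => //; last exact: cvg_G_O.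
by rewrite fin_num_adde_defl.
Qed.

Let projective_limit_setT : projective_limit setT = 1%E.
Proof.
have /cvg_lim <-// := cvg_projective_limit measurableT.
by rewrite (_ : (fun k => _) = cst 1%E) ?lim_cst//; apply/funext => k;
  rewrite probability_setT.
Qed.

HB.instance Definition _ :=
  Measure_isProbability.Build _ _ R projective_limit projective_limit_setT.

Lemma projective_limit_exists : exists P : probability T R,
  forall A, measurable A -> (fun k => G k A) @ \oo --> P A.
Proof. by exists projective_limit => A; exact: cvg_projective_limit. Qed.

End projective_limit.

(** * Lebesgue measure under diagonal affine maps *)

Section affine_change_of_variables.
Context {R : realType}.

(** The scaled pushforward has the right value on half-open intervals, which characterises Lebesgue
    measure. *)
Lemma lebesgue_measure_affine (r c : R) (A : set R) : 0 < r -> measurable A ->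
  (r%:E * lebesgue_measure ((fun x : R => r * x + c)%R @^-1` A) =
   lebesgue_measure A)%E.
Proof.
move=> r0 mA.
have mf : measurable_fun [set: measurableTypeR R]
    (fun x : measurableTypeR R => r * x + c : measurableTypeR R).
  by apply: measurable_funD => //; exact: measurable_funM.
apply/esym/(@lebesgue_measure_unique _ (mscale (NngNum (ltW r0))
  (measure_function_pushforward__canonical__measure_function_Measure
    (@lebesgue_measure R) mf))) => // _ [[a b]] _ <-.
rewrite /= /mscale /= /pushforward.
rewrite (_ : _ @^-1` _ = `](a - c) / r, (b - c) / r]%classic); last first.
  apply/seteqP; split => x /=; rewrite !in_itv/= ltr_pdivrMr// ler_pdivlMr//.
    by rewrite ltrBlDr lerBrDr mulrC.
  by rewrite ltrBlDr lerBrDr mulrC.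
rewrite !lebesgue_measure_itv/= !lte_fin ltr_pM2r ?invr_gt0// ltrD2r.
case: ifPn => ab; last by rewrite mule0.
by rewrite -!EFinB -EFinM; congr (_%:E); field; rewrite gt_eqF.
Qed.

Definition taffine n (r c : 'I_n -> R) (x : n.-tuple R) : n.-tuple R :=
  [tuple r j * tnth x j + c j | j < n].

Lemma measurable_taffine n (r c : 'I_n -> R) :
  measurable_fun [set: n.-tuple R] (taffine r c).
Proof.
apply/measurable_fun_tnthP => i /=.
rewrite (_ : _ \o _ = (fun x : n.-tuple R => r i * tnth x i + c i)); last first.
  by apply/funext => x /=; rewrite tnth_mktuple.
apply: measurable_funD => //; apply: measurable_funM => //.
exact: measurable_tnth.
Qed.

HB.instance Definition _ n (r c : 'I_n -> R) :=
  isMeasurableFun.Build _ _ _ _ (taffine r c) (measurable_taffine r c).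

(** By induction on the dimension: the map acts separately on head and tail, and agreement on
    rectangles determines the product measure. *)
Lemma lebesgue_tuple_affine n (r c : 'I_n -> R) (A : set (n.-tuple R)) :
  (forall j, 0 < r j) -> measurable A ->
  ((\prod_j r j)%R%:E * lebesgue_tuple n (taffine r c @^-1` A) =
   lebesgue_tuple n A)%E.
Proof.
elim: n r c A => [r c A _ mA|n IH r c A r0 mA].
  rewrite big_ord0 mul1e; congr (lebesgue_tuple 0 _).
  by apply/seteqP; split => x /=; rewrite [taffine _ _ _]tuple0 [x]tuple0.
pose r' j := r (lift ord0 j); pose c' j := c (lift ord0 j).
have r'0 j : 0 < r' j by exact: r0.
pose f (x : measurableTypeR R) : measurableTypeR R := r ord0 * x + c ord0.
have mf : measurable_fun setT f.
  by apply: measurable_funD => //; exact: measurable_funM.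
pose g (p : measurableTypeR R * n.-tuple R) := (f p.1, taffine r' c' p.2).
have mg : measurable_fun setT g.
  apply: measurable_fun_pair; first exact: measurableT_comp.
  by apply: measurableT_comp => //; exact: measurable_taffine.
have mcA : measurable (@cons_pair R n @^-1` A).
  by rewrite -[X in measurable X]setTI; exact: measurable_cons_pair.
have p0 : 0 <= \prod_j r j by apply: prodr_ge0 => j _; exact: ltW.
rewrite /= /lebesgue_cons /pushforward.
rewrite (_ : _ @^-1` (taffine r c @^-1` A) = g @^-1` (@cons_pair R n @^-1` A));
    last first.
  have E p : taffine r c (cons_pair p) = cons_pair (g p).
    apply: eq_from_tnth => j; rewrite tnth_mktuple /cons_pair/=.
    case: (unliftP ord0 j) => [i ->|->]; last by [].
    by rewrite !tnthS tnth_mktuple.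
  by apply/seteqP; split => p /=; rewrite E.
apply/esym/(@product_measure_unique _ _ _ _ R lebesgue_measure
  (lebesgue_tuple n) (mscale (NngNum p0)
  (measure_function_pushforward__canonical__measure_function_Measure
    (lebesgue_measure \x lebesgue_tuple n)%E mg))) => // B C mB mC.
rewrite /= /mscale /= /pushforward.
rewrite (_ : g @^-1` _ = (f @^-1` B) `*` (taffine r' c' @^-1` C))//.
rewrite product_measure1E; last 2 first.
- by rewrite -[X in measurable X]setTI; exact: mf.
- by rewrite -[X in measurable X]setTI; exact: measurable_taffine.
rewrite -(IH r' c' C)// -(lebesgue_measure_affine (c ord0) (r0 ord0) mB).
by rewrite big_ord_recl EFinM muleACA.
Qed.

(** The Jacobian times the pushforward of Lebesgue measure is Lebesgue measure, so f may be
    integrated against the former and pulled back. *)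
Lemma ge0_integral_lebesgue_tuple_affine n (r c : 'I_n -> R)
    (A : set (n.-tuple R)) (f : n.-tuple R -> \bar R) :
  (forall j, 0 < r j) -> measurable A -> measurable_fun setT f ->
  (forall x, 0 <= f x)%E ->
  (\int[lebesgue_tuple n]_(x in A) f x =
   (\prod_j r j)%R%:E *
   \int[lebesgue_tuple n]_(x in taffine r c @^-1` A) f (taffine r c x))%E.
Proof.
move=> r0 mA mf f0.
have p0 : 0 <= \prod_j r j by apply: prodr_ge0 => j _; exact: ltW.
rewrite -(@ge0_integral_pushforward _ _ _ _ _ _ (measurable_taffine r c)
  (lebesgue_tuple n) A f)//; last first.
  exact: measurable_funS mf.
rewrite -(@ge0_integral_mscale _ _ _
  (measure_function_pushforward__canonical__measure_function_Measure
    (lebesgue_tuple n) (measurable_taffine r c)) A mA (NngNum p0))//; last first.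
  exact: measurable_funS mf.
apply: eq_measure_integral => B mB _.
exact: (esym (lebesgue_tuple_affine c r0 mB)).
Qed.

End affine_change_of_variables.

(** * Two limits of exponential type *)

Section exponential_limits.
Context {R : realType}.

Lemma bernoulli_inequality (s : R) k : 0 <= s <= 1 -> 1 - k%:R * s <= (1 - s) ^+ k.
Proof.
move=> /andP[s0 s1]; elim: k => [|k IH]; first by rewrite mul0r subr0 expr0.
rewrite exprS (@le_trans _ _ ((1 - s) * (1 - k%:R * s)))//.
  rewrite -subr_ge0 -natr1.
  rewrite (_ : _ - _ = k%:R * s ^+ 2); last by ring.
  by rewrite mulr_ge0// sqr_ge0.
by rewrite ler_wpM2l// subr_ge0.
Qed.

(** With s = V/k, raise e^(-s) (1 - s^2) <= 1 - s <= e^(-s) to the power k; Bernoulli bounds (1 -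
    s^2)^k below by 1 - V^2/k. *)
Lemma cvg_one_sub_divn (V : R) : 0 <= V ->
  (fun k : nat => (1 - V / k%:R) ^+ k) @ \oo --> expR (- V).
Proof.
move=> V0.
apply: (@squeeze_cvgr _ _ _ _ (fun k : nat => expR (- V) * (1 - V ^+ 2 / k%:R))
  (fun=> expR (- V))).
- near=> k.
  have k0 : 0 < k%:R :> R by near: k; exact: nbhs_infty_gtr.
  have Vk : V <= k%:R by near: k; exact: nbhs_infty_ger.
  set s := V / k%:R.
  have s0 : 0 <= s by rewrite divr_ge0// ltW.
  have s1 : s <= 1 by rewrite ler_pdivrMr// mul1r.
  have eV : expR (- V) = expR (- s) ^+ k.
    by rewrite -expRM_natl mulrN /s mulrCA divff ?mulr1// gt_eqF.
  have s2 : 0 <= 1 - s ^+ 2 by rewrite subr_ge0 exprn_ile1.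
  rewrite eV; apply/andP; split; last first.
    by apply: lerXn2r; rewrite ?nnegrE ?expR_ge0 ?subr_ge0//; exact: expR_ge1Dx.
  rewrite (@le_trans _ _ (expR (- s) ^+ k * (1 - s ^+ 2) ^+ k))//.
    rewrite ler_wpM2l ?exprn_ge0 ?expR_ge0//.
    rewrite (_ : V ^+ 2 / k%:R = k%:R * s ^+ 2); last first.
      by rewrite /s; field; rewrite gt_eqF.
    by apply: bernoulli_inequality; rewrite sqr_ge0 exprn_ile1.
  rewrite -exprMn.
  apply: lerXn2r; rewrite ?nnegrE ?mulr_ge0 ?expR_ge0 ?s2 ?subr_ge0//.
  rewrite (_ : 1 - s ^+ 2 = (1 + s) * (1 - s)); last by ring.
  rewrite mulrA ler_piMl ?subr_ge0// expRN mulrC ler_pdivrMr ?expR_gt0// mul1r.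
  exact: expR_ge1Dx.
- rewrite -[X in _ --> X]mulr1; apply: cvgM; first exact: cvg_cst.
  rewrite -[X in _ --> X]subr0; apply: cvgB; first exact: cvg_cst.
  rewrite -[X in _ --> X](mulr0 (V ^+ 2)); apply: cvgM; first exact: cvg_cst.
  by apply/gtr0_cvgV0; [exact: nbhs_infty_gtr|exact: cvgr_idn].
- exact: cvg_cst.
Unshelve. all: by end_near. Qed.

Lemma cvg_expR_Nexp (q : R) : 0 < q ->
  (fun k : nat => expR (- expR k%:R * q)) @ \oo --> 0.
Proof.
move=> q0.
apply: (@squeeze_cvgr _ _ _ _ (fun=> 0) (fun k : nat => q^-1 * k%:R^-1)).
- near=> k.
  have k0 : 0 < k%:R :> R by near: k; exact: nbhs_infty_gtr.
  rewrite expR_ge0/= mulNr expRN -invfM lef_pV2 ?posrE ?expR_gt0 ?mulr_gt0//.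
  rewrite (le_trans _ (expR_ge1Dx _))// ler_wpDl// mulrC ler_wpM2r ?ltW//.
  by rewrite (lt_le_trans _ (expR_ge1Dx _))// ltrDr.
- exact: cvg_cst.
- rewrite -[X in _ --> X](mulr0 q^-1); apply: cvgM; first exact: cvg_cst.
  by apply/gtr0_cvgV0; [exact: nbhs_infty_gtr|exact: cvgr_idn].
Unshelve. all: by end_near. Qed.

End exponential_limits.

Lemma cvg_measure_bigsetU d (T : measurableType d) (R : realType) (I : Type)
    (s : seq I) (G : nat -> {measure set T -> \bar R}) (A : nat -> I -> set T) :
  (forall k i, measurable (A k i)) ->
  (forall i, (fun k => G k (A k i)) @ \oo --> 0%E) ->
  (fun k => G k (\big[setU/set0]_(i <- s) A k i)) @ \oo --> 0%E.
Proof.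
move=> mA GA; elim: s => [|i s IH].
  under eq_fun do rewrite big_nil measure0.
  exact: cvg_cst.
under eq_fun do rewrite big_cons.
apply: (@squeeze_cvge _ _ _ _ (cst 0%E) _
  (fun k => G k (A k i) + G k (\big[setU/set0]_(i <- s) A k i))%E).
- apply: nearW => k; rewrite measure_ge0/=; apply: measureU2 => //.
  exact: bigsetU_measurable.
- exact: cvg_cst.
- by rewrite -[X in _ --> X]adde0; apply: cvgeD.
Qed.

(** * Truncation from below as a measurable map *)

Section tmax_left.
Context {R : realType} {n : nat}.

Lemma measurable_tmax (b : n.-tuple R) : measurable_fun setT (tmax b).
Proof.
apply: (@measurableT_comp _ _ _ _ _ _ (@tmax_pair R n) _ (fun x => (b, x))).
  exact: measurable_tmax_pair.
exact: measurable_pair1.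
Qed.

HB.instance Definition _ b :=
  isMeasurableFun.Build _ _ _ _ (tmax b) (measurable_tmax b).

Lemma tmax_lower_orthant_unique (P Q : probability (n.-tuple R) R) b :
  (forall y, P (tmax b @^-1` lower_orthant y) = Q (lower_orthant y)) ->
  forall A, measurable A -> P (tmax b @^-1` A) = Q A.
Proof.
exact: (@probability_lower_orthant_unique _ _ (distribution P (tmax b)) Q).
Qed.

End tmax_left.

(** * The limit law of a threshold-stable distribution *)

Section threshold_stability.
Context {R : realType} {n : nat}.
Local Notation T := (n.-tuple R).
Variables (F : probability T R) (u : T) (r c : R -> 'I_n -> R).
Local Notation S t := (taffine (r t) (c t)).
Hypothesis r_gt0 : forall t j, 0 < r t j.
Hypothesis S0 : forall x, S 0 x = x.
Hypothesis SD : forall s t x, S (s + t) x = S s (S t x).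
Hypothesis S_threshold : forall t j, 0 <= t -> tnth u j <= tnth (S t u) j.
Hypothesis F_stable : forall t A, 0 <= t -> measurable A ->
  A `<=` ~` lower_orthant u -> F (S (- t) @^-1` A) = ((expR (- t))%:E * F A)%E.
Hypothesis F_exceed : forall j, (0 < F (~` [set x | tnth x j <= tnth u j]%R))%E.

Let S_mono t x y j : (tnth (S t x) j <= tnth (S t y) j) = (tnth x j <= tnth y j).
Proof. by rewrite !tnth_mktuple lerD2r ler_pM2l. Qed.

Let SK t x : S t (S (- t) x) = x. Proof. by rewrite -SD subrr S0. Qed.

Let S_le t x y j : (tnth (S (- t) x) j <= tnth y j) = (tnth x j <= tnth (S t y) j).
Proof. by rewrite -[LHS](S_mono t) SK. Qed.

Let S_lower t y : S (- t) @^-1` lower_orthant y = lower_orthant (S t y).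
Proof. by apply/seteqP; split => x /= h j; have := h j; rewrite S_le. Qed.

Let b k := S (- k%:R) u.

Let b_le k j y : (tnth (b k) j <= tnth y j) = (tnth u j <= tnth (S k%:R y) j).
Proof. by rewrite S_le. Qed.

Let b_ni k j : tnth (b k.+1) j <= tnth (b k) j.
Proof.
by rewrite b_le -(natr1 k) addrC SD /b SK S_threshold.
Qed.

Let mle j (a : R) : measurable [set x : T | tnth x j <= a].
Proof. exact: measurable_le_tnth. Qed.

Let mlower (y : T) : measurable (lower_orthant y).
Proof. exact: measurable_lower_orthant. Qed.

Let G k : probability T R := distribution (max_poisson F u k%:R) (S (- k%:R)).

Let lower_max_closed (y : T) : max_closed (lower_orthant y).
Proof. by move=> x x'; exact: lower_orthant_tmax. Qed.

Let le_max_closed j (a : R) : max_closed [set x : T | tnth x j <= a].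
Proof.
by move=> x x' /=; rewrite tnth_mktuple ge_max; split => [/andP|[-> ->]].
Qed.

Let G_lower k y : G k (lower_orthant y) =
  (\1_(lower_orthant (S k%:R y)) u *
   expR (- expR k%:R * fine (F (~` lower_orthant (S k%:R y)))))%:E.
Proof.
rewrite -[LHS]/(max_poisson F u k%:R (S (- k%:R) @^-1` lower_orthant y)).
by rewrite S_lower max_poissonE.
Qed.

(** The complement at time t is the preimage, under the flow run back by t - k, of the complement at
    time k, and the latter contains no point below [u]. Hence e^t times this mass does not depend on
    t. *)
Let F_lower k (t : R) y : k%:R <= t -> lower_orthant (S k%:R y) u ->
  fine (F (~` lower_orthant (S t y))) =
  expR (- t) * (expR k%:R * fine (F (~` lower_orthant (S k%:R y)))).
Proof.
move=> kt uy; have mC : measurable (~` lower_orthant (S k%:R y)).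
  exact: measurableC.
rewrite (_ : ~` _ = S (- (t - k%:R)) @^-1` ~` lower_orthant (S k%:R y)).
  rewrite F_stable ?subr_ge0//.
    by rewrite fineM ?fin_num_measure//= mulrA -expRD opprB addrC.
  by apply: subsetC => x xu j; exact: le_trans (xu j) (uy j).
by rewrite -preimage_setC S_lower -SD subrK.
Qed.

Let G_proj k A : measurable A -> G k.+1 (tmax (b k) @^-1` A) = G k A.
Proof.
move=> mA; apply: tmax_lower_orthant_unique mA => y; rewrite [RHS]G_lower.
(* If S_k y fails to dominate [u], the indicator kills the right-hand side and no truncated point
   lies below y. Otherwise the truncation drops out and [F_lower] matches the two Poisson
   exponents. *)
have [uy|uy] := pselect (lower_orthant (S k%:R y) u); last first.
  rewrite indicE memNset// mul0r (_ : _ @^-1` _ = set0) ?measure0//.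
  apply/seteqP; split => // x /= /lower_orthant_tmax[bx _]; apply: uy => j.
  by rewrite -b_le.
rewrite (_ : _ @^-1` _ = lower_orthant y); last first.
  apply/seteqP; split => x; first by move=> /lower_orthant_tmax[].
  by move=> xy; apply/lower_orthant_tmax; split => // j; rewrite b_le.
have uy1 : lower_orthant (S k.+1%:R y) u.
  move=> j; rewrite -natr1 addrC SD.
  by rewrite (le_trans (@S_threshold 1 j _))// S_mono.
rewrite G_lower !indicE !mem_set// (@F_lower k)// ?ler_nat//.
by rewrite !mulNr !mulrA expRN mulfV ?mul1r// gt_eqF// expR_gt0.
Qed.

(** As [b k] is S_(-k) u, the half-space pulls back to the same one for every k and only the Poisson
    mean grows. *)
Let G_le k j : G k [set x | tnth x j <= tnth (b k) j] =
  (expR (- expR k%:R * fine (F (~` [set x | tnth x j <= tnth u j]))))%:E.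
Proof.
rewrite -[LHS]/(max_poisson F u k%:R (S (- k%:R) @^-1`
  [set x | tnth x j <= tnth (b k) j])).
rewrite (_ : _ @^-1` _ = [set x | tnth x j <= tnth u j]); last first.
  by apply/seteqP; split => x /=; rewrite S_mono.
by rewrite max_poissonE// indicE mem_set/= ?mul1r.
Qed.

Let q_gt0 j : 0 < fine (F (~` [set x | tnth x j <= tnth u j])).
Proof.
rewrite fine_gt0// F_exceed ltey_eq fin_num_measure//.
exact: measurableC.
Qed.

Let G_upper : (fun k => G k (~` upper_orthant (b k))) @ \oo --> 0%E.
Proof.
rewrite (_ : (fun k => _) = (fun k => G k
    (\big[setU/set0]_(j <- enum 'I_n) [set x | tnth x j <= tnth (b k) j]))).
  apply: cvg_measure_bigsetU => [k j|j]; first exact: mle.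
  rewrite (_ : (fun k => _) = EFin \o (fun k => expR (- expR k%:R *
      fine (F (~` [set x | tnth x j <= tnth u j]))))); last first.
    by apply/funext => k; exact: G_le.
  by apply: cvg_EFin; [exact: nearW|exact: cvg_expR_Nexp].
apply/funext => k; congr (G k _); rewrite -bigcup_seq.
rewrite upper_orthantE setC_bigcap; apply/seteqP; split => x [j _] /=.
  by move=> /contrapT h; exists j => //=; rewrite mem_enum.
by move=> h; exists j => //=; apply.
Qed.

Let lower_le s t y : s <= t -> lower_orthant (S s y) u ->
  lower_orthant (S t y) u.
Proof.
move=> st uy j; rewrite -(subrK s t) SD.
by rewrite (le_trans (@S_threshold (t - s) j _)) ?subr_ge0// S_mono.
Qed.

Section limit_law.
Variable H : probability T R.
Hypothesis GH : forall A, measurable A -> (fun k => G k A) @ \oo --> H A.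

Let H_near A l : measurable A -> (\forall k \near \oo, G k A = l) -> H A = l.
Proof.
move=> mA Gl; apply: (cvg_unique _ (GH mA)) => //.
exact: cvg_near_cst.
Qed.

(** Undoing the rescaling moves the bound to S_k u, where stability contributes e^(-k) and cancels
    the Poisson mean e^k. *)
Let H_le j : H [set x | tnth x j <= tnth u j] =
  (expR (- fine (F (~` [set x | tnth x j <= tnth u j]))))%:E.
Proof.
apply: H_near => //; apply: nearW => k.
rewrite -[LHS]/(max_poisson F u k%:R (S (- k%:R) @^-1`
  [set x | tnth x j <= tnth u j])).
have SE : S (- k%:R) @^-1` [set x | tnth x j <= tnth u j] =
    [set x | tnth x j <= tnth (S k%:R u) j].
  by apply/seteqP; split => x /=; rewrite S_le.
rewrite SE max_poissonE// indicE mem_set/= ?mul1r; last exact: S_threshold.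
rewrite -SE preimage_setC F_stable//; last 2 first.
- exact: measurableC.
- by apply: subsetC => x; exact.
rewrite fineM ?fin_num_measure//=; last exact: measurableC.
by rewrite mulNr mulrA -expRD subrr expR0 mul1r.
Qed.

Let H_lower1 K y : lower_orthant (S K%:R y) u -> H (lower_orthant y) =
  (expR (- (expR K%:R * fine (F (~` lower_orthant (S K%:R y))))))%:E.
Proof.
move=> uy; apply: H_near => //; near=> k.
have Kk : K%:R <= k%:R :> R by rewrite ler_nat; near: k; exact: nbhs_infty_ge.
rewrite G_lower indicE mem_set; last exact: lower_le uy.
rewrite mul1r (F_lower Kk uy). by rewrite mulNr !mulrA -expRD subrr expR0 mul1r.
Unshelve. all: by end_near. Qed.

Let H_lower0 y : (forall K : nat, ~ lower_orthant (S K%:R y) u) ->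
  H (lower_orthant y) = 0%E.
Proof.
move=> uy; apply: H_near => //; apply: nearW => k.
by rewrite G_lower indicE memNset// mul0r.
Qed.

(** A margin concentrated at a would give {x_j <= u_j} mass one if a <= u_j and mass zero otherwise;
    by [H_le] that mass lies strictly between. *)
Let H_nondegenerate : nondegenerate_margins H.
Proof.
move=> j a; have mja : measurable [set x : T | tnth x j = a].
  rewrite (_ : [set _ | _] = (@tnth n R ^~ j) @^-1` [set a])//.
  by rewrite -[X in measurable X]setTI; exact: measurable_tnth.
rewrite ltNge; apply/negP => H1.
have [aj|ja] := leP a (tnth u j).
  suff : (1 <= (expR (- fine (F (~` [set x | tnth x j <= tnth u j])))) %:E)%E.
    by rewrite lee_fin leNgt expR_lt1 oppr_lt0 q_gt0.
  rewrite -H_le (le_trans H1)//; apply: le_measure; rewrite ?inE//.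
  by move=> x /= ->.
suff : ((expR (- fine (F (~` [set x | tnth x j <= tnth u j])))) %:E <= 0)%E.
  by rewrite lee_fin leNgt expR_gt0.
rewrite -H_le (@le_trans _ _ (H (~` [set x | tnth x j = a])))//.
  apply: le_measure; rewrite ?inE//; first exact: measurableC.
  by move=> x /= xj xa; move: xj; rewrite xa leNgt ja.
by rewrite probability_setC// sube_le0.
Qed.

Lemma stable_max_domain_of_attraction : max_domain_of_attraction F H.
Proof.
split; first exact: H_nondegenerate.
(* The norming constants are the coefficients of S_(-ln n), so the normalised event is {x <= S_(ln
   n) y}. *)
exists (fun k => [tuple r (- ln k%:R) j | j < n]).
exists (fun k => [tuple c (- ln k%:R) j | j < n]).
split=> [k j|y]; first by rewrite tnth_mktuple.
rewrite (_ : (fun k : nat => _) =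
    (fun k : nat => fine (F (lower_orthant (S (ln k%:R) y))) ^+ k)); last first.
  apply/funext => k; congr (fine (F _) ^+ k).
  rewrite -S_lower; apply/seteqP; split => x /= h j; have := h j;
    by rewrite !tnth_mktuple.
rewrite /distribution_function -/(lower_orthant y).
have [[K uy]|/forallNP noK] := pselect (exists K : nat, lower_orthant (S K%:R y) u).
  rewrite (H_lower1 uy) /=; set V := expR K%:R * _.
  have V0 : 0 <= V by rewrite mulr_ge0 ?expR_ge0 ?fine_ge0.
  (* From k >= e^K on, the complement of the orthant has mass exactly V / k. *)
  have := cvg_one_sub_divn V0; apply: cvg_trans; apply: near_eq_cvg; near=> k.
  have k0 : 0 < k%:R :> R by near: k; exact: nbhs_infty_gtr.
  have Kk : K%:R <= ln k%:R :> R.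
    by rewrite -[K%:R]expRK ler_ln ?posrE ?expR_gt0//; near: k;
      exact: nbhs_infty_ger.
  congr (_ ^+ k); rewrite -[X in F X]setCK probability_setC//; last first.
    exact: measurableC.
  rewrite fineB// ?fin_num_measure//; last exact: measurableC.
  by rewrite (F_lower Kk uy) expRN lnK ?posrE// mulrC.
rewrite (H_lower0 noK) /=.
(* If each coordinate of S_K y reached [u] for some K, the largest of these K would serve all
   coordinates, since the flow does not lower the threshold. *)
have [j uj] : exists j, forall K : nat, tnth (S K%:R y) j < tnth u j.
  apply/not_existsP => h.
  have /choice[K_ uK] : forall j, exists K : nat, tnth u j <= tnth (S K%:R y) j.
    move=> j; have /existsNP[K /negP] := h j.
    by rewrite -leNgt; exists K.
  pose K := (\max_j K_ j)%N; apply: (noK K) => j.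
  rewrite -[K%:R](subrK (K_ j)%:R) SD.
  rewrite (le_trans (@S_threshold (K%:R - (K_ j)%:R) j _)) ?S_mono//.
  by rewrite subr_ge0 ler_nat /K leq_bigmax.
(* Coordinate j alone forces the decay: the event lies in {x_j <= u_j}, whose mass q is below 1 by
   [F_exceed]. *)
set q := fine (F [set x | tnth x j <= tnth u j]).
have q1 : q < 1.
  have := q_gt0 j; rewrite probability_setC// fineB ?fin_num_measure//.
  by rewrite subr_gt0.
have q0 : 0 <= q by rewrite fine_ge0.
apply: (@squeeze_cvgr _ _ _ _ (fun=> 0) (fun k => q ^+ k)).
- near=> k.
  rewrite exprn_ge0 ?fine_ge0//= lerXn2r ?nnegrE ?fine_ge0//.
  apply: fine_le; rewrite ?fin_num_measure//.
  apply: le_measure; rewrite ?inE// => x /(_ j) xj /=; rewrite (le_trans xj)//.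
  (* [uj] speaks of integer times only, so ln k is rounded up to K; a coordinate above [u] at time
     ln k would still be so at time K. *)
  rewrite leNgt; apply/negP => uSy; set K := (Num.truncn (ln k%:R : R)).+1.
  have kK : ln k%:R <= K%:R :> R by apply/ltW; exact: truncnS_gt.
  have := uj K; apply/negP; rewrite -leNgt -[K%:R](subrK (ln k%:R)) SD.
  rewrite (le_trans (@S_threshold (K%:R - ln k%:R) j _)) ?subr_ge0//.
  by rewrite S_mono ltW.
- exact: cvg_cst.
- by apply: cvg_expr; rewrite ger0_norm.
Unshelve. all: by end_near. Qed.

End limit_law.

Theorem max_domain_of_attraction_of_threshold_stable :
  exists H : probability T R, max_domain_of_attraction F H.
Proof.
have [H GH] := projective_limit_exists b_ni G_proj G_upper.
by exists H; exact: stable_max_domain_of_attraction.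
Qed.

End threshold_stability.

(** A zero integral would make f vanish almost everywhere on B, putting B inside a null set. *)
Lemma integral_pos d (T : measurableType d) (R : realType)
    (mu : {measure set T -> \bar R}) (B : set T) (f : T -> \bar R) :
  measurable B -> (0 < mu B)%E -> measurable_fun B f ->
  (forall x, B x -> 0 < f x)%E -> (0 < \int[mu]_(x in B) f x)%E.
Proof.
move=> mB B0 mf f0; have fge0 x : B x -> (0 <= f x)%E by move=> /f0/ltW.
rewrite lt0e integral_ge0// andbT; apply/eqP => If0.
have /(ae_eq_integral_abs mu mB mf)[N [mN N0 BN]] :
    (\int[mu]_(x in B) `|f x| = 0)%E.
  rewrite -[RHS]If0; apply: eq_integral => x /set_mem Bx.
  by rewrite gee0_abs// fge0.
move: B0; rewrite ltNge => /negP; apply; rewrite -N0.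
apply: le_measure; rewrite ?inE// => x Bx; apply: BN => /= /(_ Bx) fx0.
by have := f0 _ Bx; rewrite fx0 ltxx.
Qed.

(** * The flow on the observation scale and the generalised Pareto density *)

Section tail_flow.
Context {R : realType} {d : nat}.
Local Notation T := (d.+1.-tuple R).
Implicit Types (a sigma gamma x z u : T).

(* Adding [t] to every coordinate of the standardised vector is the affine map
   [v |-> expR (gamma t) v + sigma boxcox gamma t] on the observation scale. *)
Definition boxcox (g t : R) : R := if g == 0 then t else (expR (g * t) - 1) / g.

Lemma boxcox0 g : boxcox g 0 = 0.
Proof. by rewrite /boxcox mulr0 expR0 subrr mul0r if_same. Qed.

(** Cocycle identity that makes the affine maps a one-parameter group. *)
Lemma boxcoxD g s t : boxcox g (s + t) = expR (g * s) * boxcox g t + boxcox g s.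
Proof.
rewrite /boxcox; case: eqVneq => [->|g0].
  by rewrite mul0r expR0 mul1r addrC.
by rewrite mulrDr expRD; field.
Qed.

Lemma mul_boxcox g t : g * boxcox g t = expR (g * t) - 1.
Proof.
rewrite /boxcox; case: eqVneq => [->|g0]; first by rewrite !mul0r expR0 subrr.
by field.
Qed.

Lemma boxcox_ge0 g t : 0 <= t -> 0 <= boxcox g t.
Proof.
move=> t0; rewrite /boxcox; case: eqVneq => // g0.
have [gp|gn] := ltP 0 g.
  by rewrite divr_ge0 ?(ltW gp)// subr_ge0 -expR0 ler_expR mulr_ge0// ltW.
rewrite -mulrNN mulr_ge0// ?oppr_ge0 ?invr_le0//.
by rewrite subr_le0 -expR0 ler_expR mulr_le0_ge0.
Qed.

Definition tail_shift sigma gamma (t : R) v : T :=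
  taffine (fun j => expR (tnth gamma j * t))
    (fun j => tnth sigma j * boxcox (tnth gamma j) t) v.

(** Makes the support invariant; the factors are the diagonal entries of the flow, so they will
    cancel its Jacobian. *)
Lemma mgp_support_shift sigma gamma t v j :
  tnth gamma j * tnth (tail_shift sigma gamma t v) j + tnth sigma j =
  expR (tnth gamma j * t) * (tnth gamma j * tnth v j + tnth sigma j).
Proof.
rewrite tnth_mktuple mulrDr (mulrCA _ (tnth sigma j)) mul_boxcox.
by ring.
Qed.

Lemma mgp_standardise_shift sigma gamma t v j : 0 < tnth sigma j ->
  0 < tnth gamma j * tnth v j + tnth sigma j ->
  tnth (mgp_standardise sigma gamma (tail_shift sigma gamma t v)) j =
  tnth (mgp_standardise sigma gamma v) j + t.
Proof.
move=> s0 vj; have v'E := mgp_support_shift sigma gamma t v j.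
rewrite [LHS]tnth_mktuple [X in _ = X + _]tnth_mktuple.
case: ifPn => [/eqP g0|g0].
  by rewrite tnth_mktuple g0 mul0r expR0 mul1r /boxcox eqxx; field; rewrite gt_eqF.
have E w : tnth gamma j / tnth sigma j * w + 1 =
    (tnth gamma j * w + tnth sigma j) / tnth sigma j.
  by field; rewrite gt_eqF.
rewrite !E v'E -mulrA lnM ?posrE ?expR_gt0 ?divr_gt0// expRK.
by field.
Qed.

Lemma mgp_standardise_gt0 sigma gamma v j : 0 < tnth sigma j ->
  0 < tnth gamma j * tnth v j + tnth sigma j -> 0 < tnth v j ->
  0 < tnth (mgp_standardise sigma gamma v) j.
Proof.
move=> s0 vj v0; rewrite tnth_mktuple; case: ifPn => [_|g0].
  by rewrite divr_gt0.
have E w : tnth gamma j / tnth sigma j * w + 1 =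
    (tnth gamma j * w + tnth sigma j) / tnth sigma j.
  by field; rewrite gt_eqF.
(* For negative gamma_j the logarithm is negative too, so the product is positive for either
   sign. *)
have [gp|gn] := ltP 0 (tnth gamma j).
  by rewrite mulr_gt0 ?invr_gt0// ln_gt0// ltrDr mulr_gt0// divr_gt0.
have {}gn : tnth gamma j < 0 by rewrite lt_neqAle g0.
rewrite -mulrNN mulr_gt0// ?oppr_gt0 ?invr_lt0//; apply: ln_lt0.
rewrite {1}E divr_gt0//= gtrDr -mulrA nmulr_rlt0// mulr_gt0// invr_gt0//.
Qed.

Lemma le_vmax z j : tnth z j <= vmax z.
Proof. exact: le_bigmax. Qed.

Lemma vmaxD z z' t : (forall j, tnth z' j = tnth z j + t) ->
  vmax z' = vmax z + t.
Proof.
(* The maximum folds from coordinate [ord0], so the shift must also map this starting value to that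
   of [z']. *)
move=> zz'; rewrite /vmax (big_morph (fun y : R => y + t) (id1 := tnth z' ord0)
  (op1 := Num.max)); last 2 first.
- by move=> x y; rewrite addr_maxl.
- by rewrite zz'.
by apply: eq_bigr => j _; rewrite zz'.
Qed.

(** With S for [sum_inv a], the maximum contributes exp(-t (1 + S)) and the product exp(t S). The
    sign of t keeps the maximum positive. *)
Lemma mgp_std_densityD a z z' t : 0 <= t -> 0 < vmax z ->
  (forall j, tnth z' j = tnth z j + t) ->
  mgp_std_density a z' = expR (- t) * mgp_std_density a z.
Proof.
move=> t0 z0 zz'; rewrite /mgp_std_density (vmaxD zz') z0 ltr_wpDr//.
have -> : \prod_(j < d.+1) ((tnth a j)^-1 * expR ((tnth a j)^-1 * tnth z' j)) =
    \prod_(j < d.+1) ((tnth a j)^-1 * expR ((tnth a j)^-1 * tnth z j)) *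
    expR (t * sum_inv a).
  rewrite /sum_inv mulr_sumr expR_sum -big_split/=; apply: eq_bigr => j _.
  by rewrite zz' mulrDr expRD mulrA (mulrC t).
have -> : expR (- (vmax z + t) * (1 + sum_inv a)) =
    expR (- vmax z * (1 + sum_inv a)) * expR (- t) * expR (- (t * sum_inv a)).
  by rewrite -!expRD; congr expR; ring.
set q := \prod_(j < d.+1) _; set S := sum_inv a.
have tS : expR (- (t * S)) * expR (t * S) = 1 by rewrite -expRD addNr expR0.
transitivity (expR (- t) * (expR (- vmax z * (1 + S)) / mgp_const a *
  (q / (1 + S))) * (expR (- (t * S)) * expR (t * S))).
  by move: (mgp_const a)^-1 (1 + S)^-1 => x y; ring.
by rewrite tS mulr1.
Qed.

Lemma sum_inv_gt0 a : (forall j, 0 < tnth a j) -> 0 < sum_inv a.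
Proof.
move=> a0; rewrite /sum_inv big_ord_recl ltr_wpDr ?invr_gt0//.
by apply: sumr_ge0 => j _; rewrite invr_ge0 ltW.
Qed.

Lemma mgp_std_density_gt0 a z : (forall j, 0 < tnth a j) -> 0 < vmax z ->
  0 < mgp_std_density a z.
Proof.
move=> a0 z0; rewrite /mgp_std_density z0.
have S0 := sum_inv_gt0 a0; have S1 : 0 < 1 + sum_inv a by rewrite addr_gt0.
rewrite mulr_gt0// divr_gt0 ?expR_gt0//; first by rewrite divr_gt0.
by apply: prodr_gt0 => j _; rewrite mulr_gt0 ?invr_gt0 ?expR_gt0.
Qed.

Lemma vmax_standardise_gt0 sigma gamma v j : 0 < tnth sigma j ->
  0 < tnth gamma j * tnth v j + tnth sigma j -> 0 < tnth v j ->
  0 < vmax (mgp_standardise sigma gamma v).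
Proof.
by move=> s0 gv v0; exact: lt_le_trans (mgp_standardise_gt0 s0 gv v0) (le_vmax _ _).
Qed.

Lemma mgp_density_gt0 a sigma gamma v j :
  (forall j, 0 < tnth a j) -> (forall j, 0 < tnth sigma j) ->
  (forall j, 0 < tnth gamma j * tnth v j + tnth sigma j) -> 0 < tnth v j ->
  0 < mgp_density a sigma gamma v.
Proof.
move=> a0 s0 gv vj; rewrite /mgp_density; case: ifPn => [_|/forallP//].
rewrite mulr_gt0//; last by apply: prodr_gt0 => i _; rewrite invr_gt0.
apply: mgp_std_density_gt0 => //; exact: vmax_standardise_gt0 vj.
Qed.

(** The Jacobian cancels the factors that [mgp_support_shift] brings out of the denominators,
    leaving the factor of the standardised density. *)
Lemma mgp_density_shift a sigma gamma t v j :
  (forall j, 0 < tnth sigma j) -> 0 <= t -> 0 < tnth v j ->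
  (\prod_(j < d.+1) expR (tnth gamma j * t)) *
    mgp_density a sigma gamma (tail_shift sigma gamma t v) =
  expR (- t) * mgp_density a sigma gamma v.
Proof.
move=> s0 t0 vj; rewrite /mgp_density.
under eq_forallb do rewrite mgp_support_shift pmulr_rgt0 ?expR_gt0//.
case: ifPn => [/forallP gv|_]; last by rewrite !mulr0.
rewrite (@mgp_std_densityD _ (mgp_standardise sigma gamma v) _ t)//; last 2 first.
- exact: vmax_standardise_gt0 vj.
- by move=> i; rewrite mgp_standardise_shift.
under [X in _ * (_ * X) = _]eq_bigr do rewrite mgp_support_shift invfM.
rewrite big_split/=.
have : (\prod_(j < d.+1) expR (tnth gamma j * t)) *
    \prod_(j < d.+1) (expR (tnth gamma j * t))^-1 = 1.
  rewrite -big_split/=; apply: big1 => i _.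
  by rewrite mulfV// gt_eqF// expR_gt0.
set x := \prod_(j < d.+1) expR _; set y := \prod_(j < d.+1) (expR _)^-1 => xy.
transitivity (expR (- t) * mgp_std_density a (mgp_standardise sigma gamma v) *
  (x * y) * \prod_(i < d.+1) (tnth gamma i * tnth v i + tnth sigma i)^-1).
  by ring.
by rewrite xy mulr1 mulrA.
Qed.

End tail_flow.

(** * Threshold stability and positive exceedance for the bulk-tail law *)

Section bulk_tail.
Context {R : realType} {d : nat}.
Local Notation T := (d.+1.-tuple R).
Variables (u a sigma gamma : T).
Hypothesis a_gt0 : forall j, 0 < tnth a j.
Hypothesis sigma_gt0 : forall j, 0 < tnth sigma j.
Variables (Fbulk : probability T R) (fbulk : T -> R).
Hypothesis Fbulk_u : distribution_function Fbulk u < 1.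
Local Notation f := (bulk_tail_density Fbulk fbulk u a sigma gamma).

Definition flow_scale (t : R) (j : 'I_d.+1) : R := expR (tnth gamma j * t).

(** Chosen so that S_t x = u + [tail_shift] (x - u): the tail flow conjugated by translation to the
    threshold. *)
Definition flow_shift (t : R) (j : 'I_d.+1) : R :=
  (1 - expR (tnth gamma j * t)) * tnth u j +
  tnth sigma j * boxcox (tnth gamma j) t.

Local Notation S t := (taffine (flow_scale t) (flow_shift t)).

Lemma flow0 x : S 0 x = x.
Proof.
apply: eq_from_tnth => j.
rewrite tnth_mktuple /flow_scale /flow_shift mulr0 expR0 boxcox0.
by rewrite mul1r subrr mul0r mulr0 !addr0.
Qed.

Lemma flowD s t x : S (s + t) x = S s (S t x).
Proof.
apply: eq_from_tnth => j; rewrite !tnth_mktuple /flow_scale /flow_shift.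
by rewrite boxcoxD mulrDr expRD; ring.
Qed.

Lemma flow_threshold t j : 0 <= t -> tnth u j <= tnth (S t u) j.
Proof.
move=> t0; rewrite tnth_mktuple /flow_scale /flow_shift addrA -mulrDl subrKC.
rewrite mul1r lerDl; apply: mulr_ge0; [exact: ltW|exact: boxcox_ge0].
Qed.

(** The flow never brings an exceedance back below [u], so the tail branch applies at both x and S_t
    x. *)
Lemma bulk_tail_density_flow t x : 0 <= t -> ~ lower_orthant u x ->
  (\prod_(j < d.+1) flow_scale t j) * f (S t x) = expR (- t) * f x.
Proof.
move=> t0 xu; rewrite /bulk_tail_density !ifN; last 2 first.
- by apply/forallP.
- apply/forallP => h; apply: xu => j.
  have := h j; rewrite leNgt => /negP; rewrite leNgt => Su; apply/negP => ux.
  apply: Su; rewrite (le_lt_trans (flow_threshold j t0))//.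
  by rewrite !tnth_mktuple ltrD2r ltr_pM2l// expR_gt0.
have [j uj] : exists j, tnth u j < tnth x j.
  by apply/not_existsP => h; apply: xu => j; rewrite leNgt; apply/negP/h.
rewrite mulrCA [RHS]mulrCA; congr (_ * _).
rewrite -(@mgp_density_shift _ _ _ _ _ _ _ j)//; last first.
  by rewrite tnth_mktuple subr_gt0.
congr (_ * mgp_density _ _ _ _); apply: eq_from_tnth => i.
rewrite !tnth_mktuple /flow_scale /flow_shift; ring.
Qed.

Variable F : probability T R.
Hypothesis F_density : has_density F f.

(** Substituting S_t turns the preimage back into A; as A consists of exceedances, the Jacobian
    times the density gains just the factor exp(-t). *)
Lemma bulk_tail_stable t A : 0 <= t -> measurable A ->
  A `<=` ~` lower_orthant u -> F (S (- t) @^-1` A) = ((expR (- t))%:E * F A)%E.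
Proof.
move=> t0 mA Au; have [mf f0 FE] := F_density.
have mEf : measurable_fun [set: T] (EFin \o f) by exact/measurable_EFinP.
have mSA : measurable (S (- t) @^-1` A).
  by rewrite -[X in measurable X]setTI; exact: measurable_taffine.
have s0 j : 0 < flow_scale t j by exact: expR_gt0.
rewrite !FE// (ge0_integral_lebesgue_tuple_affine (flow_shift t) s0 mSA mEf);
  last by move=> x; rewrite lee_fin.
rewrite (_ : S t @^-1` _ = A); last first.
  by apply/seteqP; split => x /=; rewrite -flowD addNr flow0.
rewrite -ge0_integralZl//; last 3 first.
- apply: (measurable_funS measurableT) => //.
  by apply: (measurableT_comp mEf); exact: measurable_taffine.
- by move=> x _; rewrite lee_fin.
- by rewrite lee_fin prodr_ge0// => j _; exact: ltW.
rewrite -ge0_integralZl//; last 2 first.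
- exact: measurable_funTS.
- by move=> x _; rewrite lee_fin.
apply: eq_integral => x /set_mem/Au xu.
by rewrite -!EFinM bulk_tail_density_flow.
Qed.

(** A small box just above [u] has positive volume and lies in the support; [Fbulk_u] makes the tail
    weight, hence the density there, positive. *)
Lemma bulk_tail_exceed j :
  (0 < F (~` [set x | tnth x j <= tnth u j]%R))%E.
Proof.
have [mf f0 FE] := F_density.
(* Side lengths with |gamma_k| e_k < sigma_k: then gamma_k v_k + sigma_k > 0 for 0 < v_k < e_k,
   whatever the sign of gamma_k. *)
pose e k := tnth sigma k / (`|tnth gamma k| + 1).
have e0 k : 0 < e k by rewrite divr_gt0// ltr_wpDl.
pose I k : set R := `]tnth u k, (tnth u k + e k)%R[%classic.
pose B : set T := [set x | forall k, I k (tnth x k)].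
have mB : measurable B.
  rewrite (_ : B = \bigcap_(k in [set: 'I_d.+1]) (@tnth _ R ^~ k) @^-1` I k).
    apply: fin_bigcap_measurable => // k _; rewrite -[X in measurable X]setTI.
    by apply: measurable_tnth => //; exact: measurable_itv.
  by apply/seteqP; split => x /= h k; [move=> _|]; exact: h.
apply: (@lt_le_trans _ _ (F B)); last first.
  apply: le_measure; rewrite ?inE//.
    by apply: measurableC; exact: measurable_le_tnth.
  move=> x /(_ j); rewrite /I/= in_itv/= => /andP[uj _].
  by apply/negP; rewrite -ltNge.
rewrite FE//; apply: integral_pos => //.
- suff : (0 < \prod_(k < d.+1) lebesgue_measure (I k : set (measurableTypeR R)))%E.
    by rewrite -lebesgue_tuple_box// => k; exact: measurable_itv.
  under eq_bigr => k _.
    rewrite lebesgue_measure_itv/= lte_fin ltrDl e0 -EFinB addrAC subrr add0r.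
    over.
  by rewrite prodEFin lte_fin prodr_gt0.
- apply/measurable_EFinP; exact: measurable_funS mf.
move=> x Bx; have ux k : tnth u k < tnth x k < tnth u k + e k.
  by have := Bx k; rewrite /I/= in_itv.
rewrite lte_fin /bulk_tail_density ifN; last first.
  by apply/forallP => /(_ j); have /andP[] := ux j; rewrite leNgt => ->.
rewrite mulr_gt0 ?subr_gt0//.
apply: (@mgp_density_gt0 _ _ _ _ _ _ j) => // [k|]; last first.
  by rewrite tnth_mktuple subr_gt0; have /andP[] := ux j.
rewrite tnth_mktuple; set v := _ - _.
have /andP[v0 ve] : 0 < v < e k.
  by have := ux k; rewrite /v subr_gt0 ltrBlDl.
have gv : `|tnth gamma k| * v < tnth sigma k.
  move: ve; rewrite /e ltr_pdivlMr ?ltr_wpDl// => ve.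
  by rewrite (le_lt_trans _ ve)// mulrC ler_wpM2l ?(ltW v0)// lerDl.
have : - (`|tnth gamma k| * v) <= tnth gamma k * v.
  by rewrite -mulNr ler_wpM2r ?(ltW v0)// lerNl ler_normr lexx orbT.
by move: gv; lra.
Qed.

End bulk_tail.

Theorem proposition1 (R : realType) (d : nat)
    (u a sigma gamma : d.+1.-tuple R)
    (a_gt0 : forall j, 0 < tnth a j)
    (sigma_gt0 : forall j, 0 < tnth sigma j)
    (Fbulk : probability (d.+1.-tuple R) R) (fbulk : d.+1.-tuple R -> R)
    (Fbulk_density : has_density Fbulk fbulk)
    (Fbulk_u : distribution_function Fbulk u < 1)
    (F : probability (d.+1.-tuple R) R)
    (F_density :
      has_density F (bulk_tail_density Fbulk fbulk u a sigma gamma)) :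
  exists G : probability (d.+1.-tuple R) R,
    multivariate_gev G /\ max_domain_of_attraction F G.
Proof.
have [G FG] := max_domain_of_attraction_of_threshold_stable
  (fun t j => expR_gt0 (tnth gamma j * t)) (@flow0 R d u sigma gamma)
  (@flowD R d u sigma gamma) (flow_threshold u gamma sigma_gt0)
  (bulk_tail_stable sigma_gt0 F_density)
  (bulk_tail_exceed a_gt0 sigma_gt0 Fbulk_u F_density).
(* G is an extreme value law because it arises as a limit, with F itself as the attracted law. *)
by exists G; split => //; exists F.
Qed.
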